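(* Let $\psi_u$ and $\psi_{\tilde u}$ be independent, each uniformly distributed on $(0,2\pi)$. Then, conditioned on $t=\frac34-\frac{\psi_u}{2\pi}$ (equivalently, on $\psi_u$), the CDF of $Y_{\tilde u}$ is, for $Y\in[0,\zeta_{\tilde u}/V^2]$, $$F_{Y_{\tilde u}}(Y\mid t)=1-\frac{1}{\pi}\arccos\!\Big(\frac{2V^2}{\zeta_{\tilde u}}Y-1\Big),\qquad V=\frac{\sin(\pi/\mu)}{W}.$$ Since this does not depend on $t$, $Y_{\tilde u}$ is independent of $\psi_u$ and hence of $\alpha_{\mathrm I}$.
   Context: Setup: Let $W\ge 1$ be an integer and $\mu\ge 2$ an even integer, and set $K=\mu W+1$. Let $\zeta_u>0$, and for $k=1,\dots,K$ let $h_{u,k}=\zeta_u^{1/2}e^{j(\psi_u+2\pi(k-1)/\mu)}$, where $j=\sqrt{-1}$. Let $\mathcal K_1=\{k\in\{2,\dots,K\}:\operatorname{Re}(h_{u,k})>0\}$ and $\alpha_{\mathrm I}=\big(\sum_{k\in\mathcal K_1}\operatorname{Re}(h_{u,k})\big)^2$. For an interfering user $\tilde u$ with $\zeta_{\tilde u}>0$ and phase $\psi_{\tilde u}$, let $h_{\tilde u,k}=\zeta_{\tilde u}^{1/2}e^{j(\psi_{\tilde u}+2\pi(k-1)/\mu)}$ and $Y_{\tilde u}=\big(\sum_{k\in\mathcal K_1}\operatorname{Re}(h_{\tilde u,k})\big)^2$. *)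

(* Defs.v *)
From HB Require Import structures.
From mathcomp Require Import all_boot all_order all_algebra.
From mathcomp Require Import all_classical all_reals all_analysis.
Set Implicit Arguments. Unset Strict Implicit. Unset Printing Implicit Defensive.
Import Order.TTheory GRing.Theory Num.Theory.
Import numFieldNormedType.Exports.
Local Open Scope classical_set_scope.
Local Open Scope ring_scope.




(* Re(h_{.,k}) with h_{.,k} = zeta^{1/2} e^{j (psi + 2 pi (k-1)/mu)}
   i.e. zeta^{1/2} cos(psi + 2 pi (k-1)/mu). *)
Definition reh {R : realType} (mu : nat) (zeta psi : R) (k : nat) : R :=
  Num.sqrt zeta * cos (psi + 2 * pi * (k.-1)%:R / mu%:R).

Definition K1 {R : realType} (mu W : nat) (zeta_u psi_u : R) : seq nat :=
  [seq k <- iota 2 (mu * W) | 0 < reh mu zeta_u psi_u k].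

Definition alphaI {R : realType} (mu W : nat) (zeta_u psi_u : R) : R :=
  (\sum_(k <- K1 mu W zeta_u psi_u) reh mu zeta_u psi_u k) ^+ 2.

Definition Yt {R : realType} (mu W : nat) (zeta_u psi_u zeta_t psi_t : R) : R :=
  (\sum_(k <- K1 mu W zeta_u psi_u) reh mu zeta_t psi_t k) ^+ 2.

Definition Vc (R : realType) (mu W : nat) : R := sin (pi / mu%:R) / W%:R.

Definition phase_set (R0 : realType) : set R0 := `]0, 2 * (pi : R0)[.


Arguments phase_set R0 : clear implicits.
Arguments Vc R mu W : clear implicits.

(* Main.v *)
Require Import Defs.
From HB Require Import structures.
From mathcomp Require Import all_boot all_order all_algebra.
From mathcomp Require Import all_classical all_reals all_analysis.
From mathcomp Require Import measurable_realfun.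
From mathcomp Require Import zify ring lra.
Import Order.TTheory GRing.Theory Num.Theory.
Import numFieldNormedType.Exports.
Local Open Scope classical_set_scope.
Local Open Scope ring_scope.

(** For psi_u outside a countable set, K1 consists of W full copies of mu/2
    consecutive residues modulo mu, and a telescoping sum gives
    Y = zeta_t / V^2 * cos (psi_t + c)^2 with c depending only on psi_u.  The uniform law
    on the circle is invariant under rotation, so the conditional law of Y does not
    depend on c; the independence claims follow by integrating over psi_u. *)

(** * Cosine sums and sums of periodic sequences *)

Lemma cosD2piMn {R : realType} (x : R) (k : nat) : cos (x + 2 * pi * k%:R) = cos x.
Proof.
elim: k => [|k IHk]; first by rewrite mulr0 addr0.
rewrite -[RHS]IHk -[RHS]cosD2pi; congr cos.
by rewrite -natr1; ring.
Qed.

(** The factor [2 * sin (d / 2)] turns each term into a difference of sines at angles [d] apart, so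
    the sum telescopes. Keeping it on the left avoids any condition on [d]. *)
Lemma sum_cos_arith {R : realType} (x d : R) (n : nat) :
  2 * sin (d / 2) * (\sum_(i < n) cos (x + d * i%:R)) =
  sin (x + d * n%:R - d / 2) - sin (x - d / 2).
Proof.
elim: n => [|n IHn]; first by rewrite big_ord0 !mulr0 addr0 subrr.
rewrite big_ord_recr mulrDr IHn /=.
have -> : x + d * n.+1%:R - d / 2 = (x + d * n%:R) + d / 2.
  by rewrite -natr1; field.
by rewrite (sinB (x + d * n%:R)) (sinD (x + d * n%:R)); ring.
Qed.

(** After [n] steps of [2 * pi / n.*2] the angle has advanced by [pi], so the two sines left by the
    telescoping are opposite and the factor 2 cancels. *)
Lemma sum_cos_half_turn {R : realType} (x : R) (n : nat) :
  (0 < n)%N ->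
  sin (pi / n.*2%:R) * (\sum_(i < n) cos (x + 2 * pi * i%:R / n.*2%:R)) =
  - sin (x - pi / n.*2%:R).
Proof.
move=> n0.
have n0' : n%:R != 0 :> R by rewrite pnatr_eq0 -lt0n.
have dE : n.*2%:R = 2 * n%:R :> R by rewrite -muln2 natrM mulrC.
have := sum_cos_arith x (2 * pi / n.*2%:R) n.
have -> : 2 * pi / n.*2%:R / 2 = pi / n.*2%:R :> R by rewrite dE; field.
have -> : x + 2 * pi / n.*2%:R * n%:R - pi / n.*2%:R = (x - pi / n.*2%:R) + pi.
  by rewrite dE; field.
rewrite sinDpi.
under eq_bigr => i _ do rewrite mulrAC.
move=> h; lra.
Qed.

Lemma sum_periodic_shift {V : zmodType} (f : nat -> V) (p a : nat) :
  (forall m, f (m + p)%N = f m) ->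
  \sum_(a <= m < a + p) f m = \sum_(0 <= m < p) f m.
Proof.
move=> fp; elim: a => [|a <-]; first by rewrite add0n.
apply: (addrI (f a)).
by rewrite addSn -big_ltn ?ltnS ?leq_addr// big_nat_recr ?leq_addr//= fp addrC.
Qed.

Lemma sum_periodic_mul {V : zmodType} (f : nat -> V) (p q a : nat) :
  (forall m, f (m + p)%N = f m) ->
  \sum_(a <= m < a + p * q) f m = (\sum_(0 <= m < p) f m) *+ q.
Proof.
move=> fp; elim: q => [|q IHq]; first by rewrite muln0 addn0 big_geq.
rewrite (_ : a + p * q.+1 = (a + p * q) + p)%N; last by rewrite mulnS; lia.
rewrite (@big_cat_nat _ _ _ (a + p * q)%N) /=;
  [|lia|lia].
by rewrite IHq sum_periodic_shift // mulrSr.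
Qed.

Lemma cos_gt0_pihalf_mod {R : realType} (x : R) (k : nat) :
  2 * pi * k%:R - pi / 2 < x < 2 * pi * k%:R + pi / 2 -> 0 < cos x.
Proof.
move=> hx; have -> : x = (x - 2 * pi * k%:R) + 2 * pi * k%:R by ring.
by rewrite cosD2piMn; apply: cos_gt0_pihalf; lra.
Qed.

(** The hypothesis says that [m0] is the first index whose angle has entered the open half-turn
    where cosine is positive. The angles of [m0] and the next [n - 1] indices stay in it; the
    following [n] lie in the opposite half-turn. *)
Lemma sum_cos_positive {R : realType} (n m0 k : nat) (x y : R) :
  (0 < n)%N ->
  2 * pi * k%:R - pi / 2 < x + 2 * pi * m0%:R / n.*2%:R
    < 2 * pi * k%:R - pi / 2 + 2 * pi / n.*2%:R ->
  \sum_(m0 <= m < m0 + n.*2 | 0 < cos (x + 2 * pi * m%:R / n.*2%:R))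
     cos (y + 2 * pi * m%:R / n.*2%:R) =
  \sum_(i < n) cos (y + 2 * pi * m0%:R / n.*2%:R + 2 * pi * i%:R / n.*2%:R).
Proof.
move=> n0 hx.
have dE : n.*2%:R = 2 * n%:R :> R by rewrite -muln2 natrM mulrC.
have pi0 := @pi_gt0 R.
have nR0 : 0 < n%:R :> R by rewrite ltr0n.
have dE' (t : R) : 2 * pi * t / n.*2%:R = pi * (t / n%:R).
  by rewrite dE; field; rewrite gt_eqF.
have angle (z : R) (i : nat) : z + 2 * pi * (i + m0)%:R / n.*2%:R =
    z + 2 * pi * m0%:R / n.*2%:R + 2 * pi * i%:R / n.*2%:R.
  by rewrite natrD mulrDr mulrDl [X in _ + X]addrC addrA.
rewrite -{1}[m0]add0n big_addn addKn.
rewrite (@big_cat_nat _ _ _ n) /=; [|lia|lia].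
(* Second half of the period: adding [pi] to the angle lands in the positive half-turn numbered
   [k.+1], so the filter rejects these indices. *)
rewrite [X in _ + X]big_nat_cond [X in _ + X]big1 ?addr0; last first.
  move=> i /andP[/andP[ni ni2]]; rewrite ltNge => /negP[].
  rewrite angle -oppr_ge0 -cosDpi ltW// (@cos_gt0_pihalf_mod _ _ k.+1)//.
  have h1 : 1 <= i%:R / n%:R :> R by rewrite ler_pdivlMr// mul1r ler_nat.
  have h2 : i%:R / n%:R + 1 / n%:R <= 2 :> R.
    by rewrite -mulrDl ler_pdivrMr// natr1 -dE ler_nat.
  rewrite -(natr1 k).
  move: hx.
  have -> : 2 * pi / n.*2%:R = pi * (1 / n%:R) :> R by rewrite -dE' mulr1.
  rewrite !dE'.
  have := ler_wpM2l (ltW pi0) h1; have := ler_wpM2l (ltW pi0) h2.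
  (* With the quotients abstracted, the bounds are linear in their products with [pi]. *)
  by move: (i%:R / n%:R) (1 / n%:R) (m0%:R / n%:R) => u v w; lra.
rewrite big_mkord big_mkcond; apply: eq_bigr => i _.
rewrite !angle ifT // (@cos_gt0_pihalf_mod _ _ k)//.
have h1 : 0 <= i%:R / n%:R :> R by rewrite divr_ge0.
have h2 : i%:R / n%:R + 1 / n%:R <= 1 :> R.
  by rewrite -mulrDl ler_pdivrMr// natr1 mul1r ler_nat.
move: hx.
have -> : 2 * pi / n.*2%:R = pi * (1 / n%:R) :> R by rewrite -dE' mulr1.
rewrite !dE'.
have := ler_wpM2l (ltW pi0) h1; have := ler_wpM2l (ltW pi0) h2.
by move: (i%:R / n%:R) (1 / n%:R) (m0%:R / n%:R) => u v w; lra.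
Qed.

(** * Lebesgue measure and rotations of the circle *)

Lemma lebesgue_measure_shift {R : realType} (c : R) (A : set R) :
  measurable A ->
  (@lebesgue_measure R) [set x | A (x + c)] = (@lebesgue_measure R) A.
Proof.
move=> mA.
pose f : measurableTypeR R -> measurableTypeR R := fun x => x + c.
have mf : measurable_fun setT f.
  by apply: measurable_funD => //; exact: measurable_cst.
transitivity (pushforward (@lebesgue_measure R) f A) => //.
apply/esym/lebesgue_measure_unique => //= _ [[a b]] _ <-.
rewrite /pushforward /=.
have -> : f @^-1` [set` `]a, b]] = [set` `](a - c), (b - c)]].
  by apply/seteqP; split => x; rewrite /f /= !in_itv /= ltrBlDr lerBrDr.
rewrite !lebesgue_measure_itv /= !lte_fin ltrD2r.
by case: ifP => // _; rewrite -!EFinB; congr EFin; ring.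
Qed.

(** Only the null set [[set a; b]] is affected by the choice of bounds. This allows passing from the
    open interval of phases to half-open intervals, which split without loss, or to closed ones. *)
Lemma lebesgue_measure_itv_bounds {R : realType} (a b : R) (x y : bool) (S : set R) :
  measurable S ->
  (@lebesgue_measure R) ([set` Interval (BSide x a) (BSide y b)] `&` S) =
  (@lebesgue_measure R) (`]a, b[ `&` S).
Proof.
move=> mS; set I := [set` _]; have mI : measurable I by exact: measurable_itv.
have mab : measurable ([set a; b] : set R) by apply: measurableU; exact: measurable_set1.
have mN : measurable (I `&` S `&` [set a; b]).
  by apply: measurableI => //; exact: measurableI.
have -> : I `&` S = (`]a, b[ `&` S) `|` (I `&` S `&` [set a; b]).
  apply/seteqP; split => z.
    move=> [Iz Sz].
    have [[za|zb]|zab] := pselect ([set a; b] z); first by right; split => //; left.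
      by right; split => //; right.
    left; split => //; move: Iz; rewrite /I /= !in_itv /= => /andP[az zb].
    have [za zb'] : z <> a /\ z <> b by split => ?; apply: zab; [left|right].
    apply/andP; split; rewrite lt_neqAle.
      by rewrite eq_sym (introN eqP za); exact: lteifW az.
    by rewrite (introN eqP zb'); exact: lteifW zb.
  move=> [[abz Sz]|[[]]//]; split => //.
  move: abz; rewrite /I /= !in_itv /= => /andP[az zb].
  by apply/andP; split; rewrite lteifS.
apply: measureU0 => //; first by apply: measurableI => //; exact: measurable_itv.
apply: (@subset_measure0 _ _ _ (@lebesgue_measure R) _ _ mN mab); first by move=> z [].
by apply: null_set_setU; solve [exact: lebesgue_measure_set1 | exact: measurable_set1].
Qed.

(* Splitting ]c, c + p[ at p and moving the right-hand piece back by p turns it into ]0, p[. *)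
Lemma lebesgue_measure_periodic_shift {R : realType} (p c : R) (S : set R) :
  0 <= c < p -> measurable S -> (forall x, S (x + p) = S x) ->
  (@lebesgue_measure R) (`]0, p[ `&` [set x | S (x + c)]) =
  (@lebesgue_measure R) (`]0, p[ `&` S).
Proof.
move=> /andP[c0 cp] mS Sp.
have mC (i : interval R) : measurable ([set` i] `&` S).
  by apply: measurableI => //; exact: measurable_itv.
transitivity ((@lebesgue_measure R) (`]c, (p + c)] `&` S)).
  rewrite (@lebesgue_measure_itv_bounds _ c (p + c) false false)//
    -(@lebesgue_measure_shift _ c _ (mC _)).
  apply: (congr1 (@lebesgue_measure R)).
  apply/seteqP; split => x /=; rewrite !in_itv /= ltrD2r.
    by move=> [/andP[x0 ->] ?]; rewrite andbT; split => //; lra.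
  by move=> [/andP[x0 ->] ?]; rewrite andbT; split => //; lra.
rewrite -(@lebesgue_measure_itv_bounds _ 0 p false false)//.
have split_at (a b d : R) : a <= b <= d ->
    (@lebesgue_measure R) (`]a, d] `&` S) =
    ((@lebesgue_measure R) (`]a, b] `&` S) + (@lebesgue_measure R) (`]b, d] `&` S))%E.
  move=> abd; rewrite -measureU; [|exact: mC|exact: mC|].
    rewrite -setIUl; apply: (congr1 (fun I => (@lebesgue_measure R) (I `&` S))).
    apply/seteqP; split => x /=; rewrite !in_itv /=.
      by case: (lerP x b) => xb /andP[h1 h2]; [left|right]; rewrite ?h1 ?h2.
    by move=> [] /andP[h1 h2]; apply/andP; split; lra.
  by apply/seteqP; split => x //= [[]]; rewrite !in_itv /= => ? _ []; lra.
rewrite (split_at c p) ?(split_at 0 c p); [|lra|lra].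
rewrite addeC; congr (_ + _)%E.
rewrite -(@lebesgue_measure_shift _ p _ (mC _)).
apply: (congr1 (@lebesgue_measure R)).
by apply/seteqP; split => x /=; rewrite !in_itv /= Sp => -[h ?]; split => //; lra.
Qed.

Lemma lebesgue_measure_periodic_shift_ge0 {R : realType} (p c : R) (S : set R) :
  0 < p -> 0 <= c -> measurable S -> (forall x, S (x + p) = S x) ->
  (@lebesgue_measure R) (`]0, p[ `&` [set x | S (x + c)]) =
  (@lebesgue_measure R) (`]0, p[ `&` S).
Proof.
move=> p0 c0 mS Sp.
(* Reduce [c] modulo [p]: the discarded [k] periods do not change membership in [S]. *)
have /andP[kc ck] := truncn_itv (divr_ge0 c0 (ltW p0)).
set k := Num.truncn _ in kc ck.
rewrite -(@lebesgue_measure_periodic_shift _ p (c - k%:R * p) S)//; last first.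
  by move: kc ck; rewrite ler_pdivlMr// ltr_pdivrMr// -natr1 => kc ck; apply/andP; split; lra.
have SpMn (x : R) (i : nat) : S (x + i%:R * p) = S x.
  elim: i => [|i IHi]; first by rewrite mul0r addr0.
  by rewrite -natr1 mulrDl mul1r addrA Sp.
apply: (congr1 (fun I => (@lebesgue_measure R) (`]0, p[ `&` I))).
apply/funext => x /=.
by rewrite -[RHS](SpMn _ k) -addrA subrK.
Qed.

(** * Sublevel sets of the squared cosine *)

Lemma cos_double_le {R : realType} (a x : R) :
  0 <= a <= pi -> 0 <= x <= pi ->
  (cos (2 * x) <= cos a) = (a / 2 <= x <= pi - a / 2).
Proof.
move=> ha hx.
have le_cos (y z : R) : 0 <= y <= pi -> 0 <= z <= pi -> (cos y <= cos z) = (z <= y).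
  by move=> hy hz; rewrite leNgt ltr_cos ?in_itv//= -leNgt.
have [xpi|xpi] := lerP (2 * x) pi.
  rewrite le_cos//; last by lra.
  by apply/idP/andP => [?|[? ?]]; [split|]; lra.
(* When [2 * x] exceeds [pi], reflect it to [2 * pi - 2 * x], back in the range where cosine
   decreases. *)
rewrite -cosN -(cosD2pi (- _)) le_cos//; last by rewrite mulr2n; lra.
rewrite -(mulr_natl pi).
by apply/idP/andP => [?|[? ?]]; [split|]; lra.
Qed.

Lemma lebesgue_measure_itvcc {R : realType} (a b : R) :
  a <= b -> (@lebesgue_measure R) (`[a, b] : set R) = (b - a)%:E.
Proof.
move=> ab; rewrite lebesgue_measure_itv /= lte_fin EFinB.
by case: ifPn => //; rewrite -leNgt => ba; rewrite (@le_anti _ _ a b) ?ab ?ba// -EFinB subrr.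
Qed.

(** With [a = acos (2 * s - 1)], the double-angle formula turns the condition into
    [cos (2 * x) <= cos a], whose solutions in each half-turn form an interval of length
    [pi - a]. *)
Lemma lebesgue_measure_cos_sqr_le {R : realType} (s : R) : 0 <= s <= 1 ->
  (@lebesgue_measure R) (`]0, (2 * pi)[ `&` [set x | cos x ^+ 2 <= s]) =
  (2 * pi - 2 * acos (2 * s - 1))%:E.
Proof.
move=> hs; have pi0 := @pi_gt0 R.
have mS : measurable [set x : R | cos x ^+ 2 <= s].
  rewrite -[X in measurable X]setTI.
  apply: measurable_fun_le => //.
  apply: measurable_funX.
  apply: continuous_measurable_fun; exact: continuous_cos.
rewrite -(@lebesgue_measure_itv_bounds _ 0 (2 * pi) true false)//.
have hv : -1 <= 2 * s - 1 <= 1 by lra.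
set a := acos _.
have a0 : 0 <= a by exact: acos_ge0.
have api : a <= pi by exact: acos_lepi.
have cosa : cos a = 2 * s - 1 by apply: acosK; rewrite in_itv.
have SE (x : R) : (cos x ^+ 2 <= s) = (cos (2 * x) <= cos a).
  by rewrite cosa mulr_natl cos_mulr2n mulr2n; apply/idP/idP; lra.
(* For [a = 0] the two intervals below would share the point [pi], so additivity on disjoint sets
   would not apply; here the condition always holds. *)
have [aE|an0] := eqVneq a 0.
  rewrite aE mulr0 subr0 [X in _ `&` X](_ : _ = setT) ?setIT.
    by rewrite [LHS]lebesgue_measure_itvcc ?subr0// mulr_ge0// ltW.
  by apply/seteqP; split => // x _ /=; rewrite SE aE cos0 cos_le1.
have {an0}a_gt0 : 0 < a by rewrite lt_neqAle eq_sym an0.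
have -> : `[0, (2 * pi)] `&` [set x | cos x ^+ 2 <= s] =
    `[a / 2, pi - a / 2] `|` `[pi + a / 2, 2 * pi - a / 2].
  apply/seteqP; split => x /=; rewrite !in_itv /= SE.
    move=> [hx]; have [xpi|xpi] := lerP x pi.
      by rewrite cos_double_le ?a0//; [left|lra].
    rewrite (_ : 2 * x = 2 * (x - pi) + pi *+ 2); last by rewrite mulr2n; ring.
    by rewrite cosD2pi cos_double_le ?a0//; lra.
  move=> [hx|hx]; (split; first by lra).
    by rewrite cos_double_le ?a0//; lra.
  rewrite (_ : 2 * x = 2 * (x - pi) + pi *+ 2); last by rewrite mulr2n; ring.
  by rewrite cosD2pi cos_double_le ?a0//; lra.
rewrite measureU; [|exact: measurable_itv|exact: measurable_itv|]; last first.
  by apply/seteqP; split => x //= []; rewrite !in_itv /=; lra.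
rewrite [X in (X + _)%E]lebesgue_measure_itvcc; last by lra.
rewrite [X in (_ + X)%E]lebesgue_measure_itvcc; last by lra.
by rewrite -EFinD; congr EFin; field.
Qed.

(** * Closed form of [Yt] for a fixed phase [psi_u] *)

Lemma sin_pi_div_gt0 {R : realType} (mu : nat) : (2 <= mu)%N -> 0 < sin (pi / mu%:R) :> R.
Proof.
move=> mu2; have muR : 2 <= mu%:R :> R by rewrite ler_nat.
have mu0 : 0 < mu%:R :> R by lra.
apply: sin_gt0_pi; rewrite divr_gt0 ?pi_gt0//= ltr_pdivrMr//.
by have := ler_wpM2l (@pi_ge0 R) muR; have := @pi_gt0 R; lra.
Qed.

(** The indices [m = k - 1] run over [W] full periods, and the filter and the summand both have
    period [mu] in [m]. The window may thus start at any [m0], in particular where the cosines turn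
    positive. *)
Lemma reh_sum_periodic {R : realType} (mu W m0 : nat) (zeta_u psi_u zeta_t psi_t : R) :
  (0 < mu)%N -> 0 < zeta_u ->
  \sum_(k <- K1 mu W zeta_u psi_u) reh mu zeta_t psi_t k =
  Num.sqrt zeta_t *
  (\sum_(m0 <= m < m0 + mu | 0 < cos (psi_u + 2 * pi * m%:R / mu%:R))
     cos (psi_t + 2 * pi * m%:R / mu%:R)) *+ W.
Proof.
move=> mu_gt0 zu.
have muR : mu%:R != 0 :> R by rewrite pnatr_eq0 -lt0n.
rewrite /K1 big_filter.
under eq_bigl => k do rewrite /reh pmulr_rgt0 ?sqrtr_gt0//.
rewrite -mulr_sumr -mulrnAr; congr (_ * _).
(* The lower bound is written [1 + 1] so that [big_addn] shifts the index by one, from [k] to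
   [k - 1]. *)
have -> : iota 2 (mu * W) = index_iota (1 + 1) (2 + mu * W) by rewrite /index_iota addKn.
rewrite big_addn (_ : 2 + mu * W - 1 = 1 + mu * W)%N; last by lia.
under eq_bigl => k do rewrite addn1 /=.
under eq_bigr => k _ do rewrite addn1 /=.
rewrite big_mkcond /= [in RHS]big_mkcond /=.
set f := BIG_F.
have fp m : f (m + mu)%N = f m.
  have angle (x : R) : cos (x + 2 * pi * (m + mu)%:R / mu%:R) = cos (x + 2 * pi * m%:R / mu%:R).
    rewrite -[RHS]cosD2pi natrD -(mulr_natl pi); congr cos.
    by field.
  by rewrite /f !angle.
by rewrite sum_periodic_mul// sum_periodic_shift.
Qed.

(* Some real part of the u-signal vanishes; writing the argument of the cosine as
   7 pi / 2 keeps the index m nonnegative for psi_u in (0, 2 pi). *)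
Definition degenerate_phases (R : realType) (mu : nat) : set R :=
  range (fun m : nat => 7 / 2 * pi - 2 * pi * m%:R / mu%:R).

Lemma Yt_cos_sqr {R : realType} (n W : nat) (zeta_u zeta_t psi_u : R) :
  (0 < n)%N -> (0 < W)%N -> 0 < zeta_u -> 0 <= zeta_t ->
  psi_u < 2 * pi -> ~ degenerate_phases R n.*2 psi_u ->
  exists2 c, 0 <= c & forall psi_t,
    Yt n.*2 W zeta_u psi_u zeta_t psi_t =
    zeta_t / Vc R n.*2 W ^+ 2 * cos (psi_t + c) ^+ 2.
Proof.
move=> n0 W0 zu zt hpsi ndeg.
have pi0 := @pi_gt0 R.
have d0 : 0 < n.*2%:R :> R by rewrite ltr0n double_gt0.
have W0' : W%:R != 0 :> R by rewrite pnatr_eq0 -lt0n.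
have sin0 : 0 < sin (pi / n.*2%:R) :> R by apply: sin_pi_div_gt0; lia.
(* [z] is the real index at which the angle reaches [7 / 2 * pi = 2 * pi * 2 - pi / 2], the start of
   a positive half-turn. Hence [m.+1] is the first index inside, and non-degeneracy makes [m < z]
   strict. *)
pose z := (7 / 2 * pi - psi_u) * n.*2%:R / (2 * pi).
have z0 : 0 <= z by apply: divr_ge0; [apply: mulr_ge0; [lra|exact: ltW]|lra].
have psiE : psi_u = 7 / 2 * pi - 2 * pi * z / n.*2%:R.
  by rewrite /z; move: (@pi R) pi0 => p p0; field; rewrite !gt_eqF.
have /andP[mz zm] := truncn_itv z0.
set m := Num.truncn z in mz zm.
have mz' : m%:R < z.
  rewrite lt_neqAle mz andbT; apply/eqP => mzE; apply: ndeg.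
  by exists m => //=; rewrite mzE [RHS]psiE.
(* The first two terms come from the half-turn sum started at [m.+1]; the last one turns its negated
   sine into a cosine. *)
pose c : R := 2 * pi * m.+1%:R / n.*2%:R - pi / n.*2%:R + pi / 2.
exists c.
  have -> : c = (2 * pi * m%:R + pi) / n.*2%:R + pi / 2.
    by rewrite /c -(natr1 m); ring.
  apply: addr_ge0; last lra.
  by apply: divr_ge0; [apply: addr_ge0; [apply: mulr_ge0|]|]; rewrite ?ler0n//; lra.
move=> psi_t; rewrite /Yt (@reh_sum_periodic _ _ _ m.+1)//; last by rewrite double_gt0.
rewrite (@sum_cos_positive _ n m.+1 2)//; last first.
  have -> : psi_u + 2 * pi * m.+1%:R / n.*2%:R =
      7 / 2 * pi + 2 * pi * (m.+1%:R - z) / n.*2%:R by rewrite psiE; ring.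
  rewrite -(natr1 m) in zm *.
  have h1 : 0 < 2 * pi * (m%:R + 1 - z) / n.*2%:R.
    by apply: divr_gt0 => //; apply: mulr_gt0; lra.
  have h2 : 2 * pi * (m%:R + 1 - z) / n.*2%:R < 2 * pi / n.*2%:R.
    by rewrite ltr_pM2r ?invr_gt0// gtr_pMr; lra.
  by apply/andP; split; lra.
have := @sum_cos_half_turn _ (psi_t + 2 * pi * m.+1%:R / n.*2%:R) n n0.
rewrite -cosDpihalf (_ : _ + pi / 2 = psi_t + c); last by rewrite /c !addrA.
move=> sumE; rewrite /Vc -sumE -mulr_natr !exprMn sqr_sqrtr// exprVn.
by move: (sin (pi / n.*2%:R)) sin0 => s s0; field; rewrite W0' gt_eqF.
Qed.

(** * Measurability, sections and the conditional law *)

Lemma measurable_reh_sum {R : realType} (mu W : nat) (zeta_u zeta_t : R) :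
  measurable_fun setT (fun p : measurableTypeR R * measurableTypeR R =>
    \sum_(k <- K1 mu W zeta_u p.1) reh mu zeta_t p.2 k).
Proof.
have mreh zeta k : measurable_fun setT (fun x : measurableTypeR R => reh mu zeta x k).
  apply: measurable_funM; first exact: measurable_cst.
  apply: (@measurableT_comp _ _ _ _ _ _ cos).
    by apply: continuous_measurable_fun; exact: continuous_cos.
  by apply: measurable_funD => //; exact: measurable_cst.
(* The index list depends on [p.1]; moving the filter into the summand leaves a sum over a fixed
   list. *)
under [X in measurable_fun _ X]eq_fun => p do rewrite /K1 big_filter big_mkcond /=.
apply: measurable_sum => k.
apply: measurable_fun_ifT; last exact: measurable_cst.
  apply: measurable_fun_ltr; first exact: measurable_cst.
  exact: (measurableT_comp (mreh zeta_u k) measurable_fst).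
exact: (measurableT_comp (mreh zeta_t k) measurable_snd).
Qed.

(** The product measure integrates the measures of the sections, and here the integrand is almost
    everywhere [g] times the indicator of [C]. This is how a conditional law free of [psi_u] yields
    a factorization. *)
Lemma product_measure_const_section {d1 d2 : measure_display}
    {T1 : measurableType d1} {T2 : measurableType d2} {R : realType}
    (m1 : {measure set T1 -> \bar R}) (m2 : {sigma_finite_measure set T2 -> \bar R})
    (C : set T1) (E : set (T1 * T2)) (g : \bar R) :
  measurable C -> measurable E -> (0 <= g)%E ->
  {ae m1, forall x, C x -> m2 (xsection E x) = g} ->
  (m1 \x m2)%E ((C `*` setT) `&` E) = (m1 C * g)%E.
Proof.
move=> mC mE g0 aeg.
have mCE : measurable ((C `*` setT) `&` E).
  by apply: measurableI => //; apply: measurableX.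
rewrite /product_measure1 /=.
have mg : measurable_fun setT ((fun x => (\1_C x)%:E * g)%E : T1 -> \bar R).
  apply: emeasurable_funM; last exact: measurable_cst.
  by apply: measurableT_comp => //; exact: measurable_indic.
rewrite (@ge0_ae_eq_integral _ _ _ m1 _ _ (fun x => ((\1_C x)%:E * g)%E))//.
- rewrite ge0_integralZr//.
  + by rewrite integral_indic ?setIT.
  + by apply: measurableT_comp => //; exact: measurable_indic.
- exact: measurable_fun_xsection.
- by move=> x _; apply: mule_ge0; rewrite ?lee_fin.
- apply: filterS aeg => x xg _ /=; rewrite indicE xsectionI.
  have [xC|xC] := boolP (x \in C).
    by rewrite in_xsectionX// setTI mul1e xg//; exact: set_mem.
  by rewrite notin_xsectionX// set0I measure0 mul0e.
Qed.

(** The conditional distribution function before division by [2 * pi], with the rotation [c] set to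
    0, so that [psi_u] does not occur. *)
Definition cdf_mass {R : realType} (mu W : nat) (zeta y : R) : \bar R :=
  (@lebesgue_measure R)
    (`]0, (2 * pi)[ `&` [set x | zeta / Vc R mu W ^+ 2 * cos x ^+ 2 <= y]).

(** The squared cosine has period [2 * pi], so rotation invariance removes [c]. All real [y] are
    covered, as the independence claims require. *)
Lemma Yt_section_measure {R : realType} (mu W : nat) (zeta_u zeta_t psi_u : R) :
  (1 <= W)%N -> (2 <= mu)%N -> ~~ odd mu -> 0 < zeta_u -> 0 <= zeta_t ->
  psi_u < 2 * pi -> ~ degenerate_phases R mu psi_u -> forall y,
  (@lebesgue_measure R)
    [set psi_t | phase_set R psi_t /\ Yt mu W zeta_u psi_u zeta_t psi_t <= y] =
  cdf_mass mu W zeta_t y.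
Proof.
move=> W1 mu2 emu zu zt hpsi ndeg y.
have muE : mu = mu./2.*2 by rewrite -[LHS]odd_double_half (negbTE emu).
rewrite muE in ndeg *.
have [||||c c0 YE] := @Yt_cos_sqr _ mu./2 W zeta_u zeta_t _ _ _ _ _ hpsi ndeg => //.
  by lia.
rewrite /cdf_mass; set S := (X in _ `&` X).
rewrite -(@lebesgue_measure_periodic_shift_ge0 _ (2 * pi) c S)//.
- apply: (congr1 (@lebesgue_measure R)).
  by apply/funext => x /=; rewrite YE.
- by rewrite mulr_gt0// pi_gt0.
- rewrite -[X in measurable X]setTI.
  apply: measurable_fun_le => //.
  apply: measurable_funM; first exact: measurable_cst.
  apply: measurable_funX.
  by apply: continuous_measurable_fun; exact: continuous_cos.
- by move=> x; rewrite /S /= mulr_natl cosD2pi.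
Qed.

Lemma degenerate_phases_ae {R : realType} (mu : nat) :
  {ae (@lebesgue_measure R), forall x, ~ degenerate_phases R mu x}.
Proof.
have cN : countable (degenerate_phases R mu) 
  by apply: sub_countable (card_image_le _ _) _; exact: countableP.
exists (degenerate_phases R mu); split.
- by apply: countable_measurable => // t; exact: measurable_set1.
- exact: countable_lebesgue_measure0.
- by move=> x /= /contrapT.
Qed.

Lemma cdf_massE {R : realType} (mu W : nat) (zeta y : R) :
  (1 <= W)%N -> (2 <= mu)%N -> 0 < zeta -> 0 <= y <= zeta / Vc R mu W ^+ 2 ->
  cdf_mass mu W zeta y = (2 * pi - 2 * acos (2 * Vc R mu W ^+ 2 / zeta * y - 1))%:E.
Proof.
move=> W1 mu2 z0 /andP[y0 yle].
have V0 : 0 < Vc R mu W ^+ 2.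
  by rewrite exprn_gt0// divr_gt0 ?sin_pi_div_gt0// ltr0n.
rewrite /cdf_mass.
have -> : [set x | zeta / Vc R mu W ^+ 2 * cos x ^+ 2 <= y] =
    [set x | cos x ^+ 2 <= Vc R mu W ^+ 2 / zeta * y].
  by apply/funext => x /=; rewrite -(invf_div zeta) ler_pdivlMl// divr_gt0.
rewrite lebesgue_measure_cos_sqr_le ?(mulrA 2) ?(mulrA 2 (Vc R mu W ^+ 2))//.
apply/andP; split; first by apply: mulr_ge0 => //; apply: divr_ge0; exact: ltW.
by rewrite -(invf_div zeta) ler_pdivrMl ?divr_gt0// mulr1.
Qed.

(** * Independence *)

Lemma measurable_phase_set (R : realType) : measurable (phase_set R).
Proof. exact: measurable_itv. Qed.

Lemma measurable_alphaI {R : realType} (mu W : nat) (zeta : R) :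
  measurable_fun setT (alphaI mu W zeta).
Proof.
apply: measurable_funX.
(* [alphaI] is the two-phase sum restricted to the diagonal, then squared. *)
apply: (measurableT_comp (measurable_reh_sum mu W zeta zeta)
  (_ : measurable_fun setT (fun x : measurableTypeR R => (x, x)))).
exact: measurable_fun_pair.
Qed.

(** Independence is stated with cross-multiplied unnormalized masses, the square of phases carrying
    the total mass. *)
Lemma Yt_independent_phase {R : realType} (W mu : nat) (zeta_u zeta_t : R)
    (A : set R) (y : R) :
  (1 <= W)%N -> (2 <= mu)%N -> ~~ odd mu -> 0 < zeta_u -> 0 <= zeta_t ->
  measurable A ->
  (((@lebesgue_measure R) \x (@lebesgue_measure R))
     [set p | phase_set R p.1 /\ phase_set R p.2 /\
              A p.1 /\ (Yt mu W zeta_u p.1 zeta_t p.2 <= y)%R]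
   * ((@lebesgue_measure R) \x (@lebesgue_measure R))
       (phase_set R `*` phase_set R))%E
  = (((@lebesgue_measure R) \x (@lebesgue_measure R))
       [set p | phase_set R p.1 /\ phase_set R p.2 /\ A p.1]
     * ((@lebesgue_measure R) \x (@lebesgue_measure R))
       [set p | phase_set R p.1 /\ phase_set R p.2 /\
                (Yt mu W zeta_u p.1 zeta_t p.2 <= y)%R])%E.
Proof.
move=> W1 mu2 emu zu zt mA.
have mph := @measurable_phase_set R.
pose E : set (measurableTypeR R * measurableTypeR R) :=
  (setT `*` phase_set R) `&` [set p | Yt mu W zeta_u p.1 zeta_t p.2 <= y].
have mE : measurable E.
  apply: measurableI; first exact: measurableX.
  rewrite -[X in measurable X]setTI; apply: measurable_fun_le => //.
  by apply: measurable_funX; exact: measurable_reh_sum.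
(* Used for [C] equal to [phase_set R] and to its intersection with [A]; both sides of the goal then
   have the same four factors. *)
have prodE (C : set R) : measurable C -> C `<=` phase_set R ->
    ((@lebesgue_measure R) \x (@lebesgue_measure R))%E ((C `*` setT) `&` E) =
    ((@lebesgue_measure R) C * cdf_mass mu W zeta_t y)%E.
  move=> mC Cph; apply: product_measure_const_section => //.
  apply: (@filterS _ _ (ae_filter_ringOfSetsType (@lebesgue_measure R)) _ _ _
    (degenerate_phases_ae mu)) => x ndeg /Cph.
  rewrite /phase_set /= in_itv /= => /andP[_ x2pi].
  rewrite -(@Yt_section_measure _ _ _ zeta_u _ x)//.
  apply: (congr1 (@lebesgue_measure R)).
  by apply/seteqP; split => z; rewrite /xsection /E /= inE /=; tauto.
have -> : [set p | phase_set R p.1 /\ phase_set R p.2 /\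
    A p.1 /\ (Yt mu W zeta_u p.1 zeta_t p.2 <= y)%R] =
    ((phase_set R `&` A) `*` setT) `&` E.
  by apply/seteqP; split => p /=; rewrite /E /=; tauto.
have -> : [set p | phase_set R p.1 /\ phase_set R p.2 /\ A p.1] =
    (phase_set R `&` A) `*` phase_set R.
  by apply/seteqP; split => p /=; tauto.
have -> : [set p | phase_set R p.1 /\ phase_set R p.2 /\
    (Yt mu W zeta_u p.1 zeta_t p.2 <= y)%R] = (phase_set R `*` setT) `&` E.
  by apply/seteqP; split => p /=; rewrite /E /=; tauto.
have mphA : measurable (phase_set R `&` A) by exact: measurableI.
rewrite !prodE//.
by rewrite !product_measure1E// muleACA [RHS]muleACA [(cdf_mass _ _ _ _ * _)%E]muleC.
Qed.

(* psi_u, psi_t independent uniform on (0, 2 pi): joint law = normalized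
   Lebesgue (product) measure on (0,2pi) x (0,2pi). *)
Theorem theorem4 (R : realType) (W mu : nat) (zeta_u zeta_t : R) :
  (1 <= W)%N -> (2 <= mu)%N -> ~~ odd mu -> 0 < zeta_u -> 0 < zeta_t ->
  (* conditional CDF of Y_{u~} given psi_u (for almost every psi_u) *)
  {ae (@lebesgue_measure R), forall psi_u : R, phase_set R psi_u ->
    forall y : R, 0 <= y <= zeta_t / Vc R mu W ^+ 2 ->
      ((@lebesgue_measure R)
         [set psi_t | phase_set R psi_t /\ (Yt mu W zeta_u psi_u zeta_t psi_t <= y)%R]
       / (2 * pi)%:E)%E
      = (1 - acos (2 * Vc R mu W ^+ 2 / zeta_t * y - 1) / pi)%:E}
  /\
  (* hence Y_{u~} is independent of psi_u ... *)
  (forall (A : set R) (y : R), measurable A ->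
    (((@lebesgue_measure R) \x (@lebesgue_measure R))
       [set p | phase_set R p.1 /\ phase_set R p.2 /\
                A p.1 /\ (Yt mu W zeta_u p.1 zeta_t p.2 <= y)%R]
     * ((@lebesgue_measure R) \x (@lebesgue_measure R))
         (phase_set R `*` phase_set R))%E
    = (((@lebesgue_measure R) \x (@lebesgue_measure R))
         [set p | phase_set R p.1 /\ phase_set R p.2 /\ A p.1]
       * ((@lebesgue_measure R) \x (@lebesgue_measure R))
         [set p | phase_set R p.1 /\ phase_set R p.2 /\
                  (Yt mu W zeta_u p.1 zeta_t p.2 <= y)%R])%E)
  /\
  (* ... and of alpha_I *)
  (forall (B : set R) (y : R), measurable B ->
    (((@lebesgue_measure R) \x (@lebesgue_measure R))
       [set p | phase_set R p.1 /\ phase_set R p.2 /\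
                B (alphaI mu W zeta_u p.1) /\ (Yt mu W zeta_u p.1 zeta_t p.2 <= y)%R]
     * ((@lebesgue_measure R) \x (@lebesgue_measure R))
         (phase_set R `*` phase_set R))%E
    = (((@lebesgue_measure R) \x (@lebesgue_measure R))
         [set p | phase_set R p.1 /\ phase_set R p.2 /\ B (alphaI mu W zeta_u p.1)]
       * ((@lebesgue_measure R) \x (@lebesgue_measure R))
         [set p | phase_set R p.1 /\ phase_set R p.2 /\
                  (Yt mu W zeta_u p.1 zeta_t p.2 <= y)%R])%E).
Proof.
move=> W1 mu2 emu zu zt; have zt' := ltW zt; split; last split.
- apply: (@filterS _ _ (ae_filter_ringOfSetsType (@lebesgue_measure R)) _ _ _
    (degenerate_phases_ae mu)) => psi_u ndeg.
  rewrite /phase_set /= in_itv /= => /andP[_ psi2pi] y hy.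
  rewrite Yt_section_measure// cdf_massE// inver.
  have pi0 := @pi_gt0 R.
  (* The inverse in [\bar R] branches on a zero argument, which positivity of [2 * pi] excludes. *)
  rewrite gt_eqF ?mulr_gt0// -EFinM; congr EFin.
  by move: (acos _) (@pi R) pi0 => a p p0; field; rewrite gt_eqF.
- by move=> A y mA; exact: Yt_independent_phase.
(* [alphaI] is a function of [psi_u] alone, so its events are events on [psi_u]. *)
- move=> B y mB; apply: (@Yt_independent_phase _ _ _ _ _ (alphaI mu W zeta_u @^-1` B)) => //.
  by rewrite -[X in measurable X]setTI; exact: measurable_alphaI.
Qed.
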